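(* Let $K\ge1$ and $d>0$. In the limit $n\to\infty$ (that is, for all sufficiently large $n$ divisible by $K$), the symmetric $K$-spike solution of the discrete system $$u_t=-u+\frac{u^2}{v},\qquad 0=d^2n^2\,\mathcal L v-v+u^2$$ on the cycle with $n$ nodes is stable when $$d<d_c:=\frac{1}{K\,\operatorname{arccosh}\!\left(2-\cos\!\left(\frac{2\pi\lfloor K/2\rfloor}{K}\right)\right)}$$ (with $d_c=+\infty$ when $K=1$).
   Context: The nodes of the cycle graph with $n$ nodes are identified with the points $x=j/n$, $j\in\mathbb Z/n\mathbb Z$, of the circle $\mathbb R/\mathbb Z$, and $(\mathcal L v)(x)=v(x+\tfrac1n)+v(x-\tfrac1n)-2v(x)$. The parameters $d$ and $K$ do not depend on $n$. The symmetric $K$-spike solution is the steady state with $v>0$, spikes located at $x_k=k/K$, $k=1,\dots,K$ (so $K\mid n$), all of equal height: $u(x_k)=v(x_k)=C>0$ for all $k$ with the same constant $C$, and $u=0$ at all other nodes. Stability means linear stability: every $\lambda\in\mathbb C$ for which there is $(\phi,\psi)\ne(0,0)$ with $$\lambda\phi=-\phi+\frac{2u_s}{v_s}\phi-\frac{u_s^2}{v_s^2}\psi,\qquad 0=d^2n^2\mathcal L\psi-\psi+2u_s\phi,$$ where $(u_s,v_s)$ is the steady state, has negative real part. *)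

(* Defs.v *)
From HB Require Import structures.
From mathcomp Require Import all_boot all_order all_algebra.
From mathcomp Require Import all_classical all_reals all_analysis.
From mathcomp.real_closed Require Import complex.

Set Implicit Arguments.
Unset Strict Implicit.
Unset Printing Implicit Defensive.

Import Order.TTheory GRing.Theory Num.Theory.
Local Open Scope ring_scope.
Local Open Scope complex_scope.

(* The node x = j/n of the cycle R/Z is represented by j : 'I_n; ordS and
   ord_pred are the cyclic successor and predecessor on 'I_n. *)
Definition laplacian (V : zmodType) (n : nat) (v : {ffun 'I_n -> V}) :
    {ffun 'I_n -> V} :=
  [ffun j => v (ordS j) + v (ord_pred j) - v j *+ 2].

Definition steady_state (R : realType) (n : nat) (d : R)
    (u v : {ffun 'I_n -> R}) : Prop :=
  forall j, - u j + u j ^+ 2 / v j = 0 /\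
            d ^+ 2 * n%:R ^+ 2 * laplacian v j - v j + u j ^+ 2 = 0.

(* For K dividing n, the point x_k = k/K is the node with index k * (n / K)
   modulo n; here k = i + 1 with i < K. *)
Definition spike_node (n K : nat) (j : 'I_n) : bool :=
  [exists i : 'I_K, j == i.+1 * (n %/ K) %[mod n]].

Definition symmetric_spike_solution (R : realType) (n K : nat) (d : R)
    (u v : {ffun 'I_n -> R}) : Prop :=
  [/\ steady_state d u v,
      forall j, 0 < v j,
      forall j, ~~ spike_node K j -> u j = 0
    & exists2 C : R, 0 < C & forall j, spike_node K j -> u j = C /\ v j = C].

Definition linear_eigenvalue (R : realType) (n : nat) (d : R)
    (us vs : {ffun 'I_n -> R}) (lambda : R[i]) : Prop :=
  exists phi psi : {ffun 'I_n -> R[i]},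
    (phi, psi) <> (0, 0) /\
    forall j,
      lambda * phi j = - phi j + (2 * us j / vs j)%:C * phi j
                       - (us j ^+ 2 / vs j ^+ 2)%:C * psi j /\
      0 = (d ^+ 2 * n%:R ^+ 2)%:C * laplacian psi j - psi j
          + (2 * us j)%:C * phi j.

Definition linearly_stable (R : realType) (n : nat) (d : R)
    (us vs : {ffun 'I_n -> R}) : Prop :=
  forall lambda : R[i], linear_eigenvalue d us vs lambda ->
    complex.Re lambda < 0.

(* Meaningful for 1 <= x, where it is the nonnegative inverse of cosh: see
   arccosh_ge0 and arccoshK. *)
Definition arccosh (R : realType) (x : R) : R := ln (x + Num.sqrt (x ^+ 2 - 1)).

Lemma arccosh_ge0 (R : realType) (x : R) : 1 <= x -> 0 <= arccosh x.
Proof. by move=> x1; apply: ln_ge0; rewrite ler_wpDr ?sqrtr_ge0. Qed.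

Lemma arccoshK (R : realType) (x : R) : 1 <= x ->
  (expR (arccosh x) + expR (- arccosh x)) / 2 = x.
Proof.
move=> x1; set s := Num.sqrt (x ^+ 2 - 1).
have ss : s ^+ 2 = x ^+ 2 - 1 by rewrite sqr_sqrtr // subr_ge0 expr_ge1 // (le_trans _ x1).
have y0 : 0 < x + s by rewrite ltr_wpDr ?sqrtr_ge0 // (lt_le_trans _ x1).
have yV : (x + s)^-1 = x - s.
  apply: (mulIf (lt0r_neq0 y0)); rewrite mulVf ?lt0r_neq0 //.
  by rewrite -subr_sqr ss subKr.
by rewrite expRN /arccosh -/s lnK ?posrE // yV addrACA subrr addr0 -mulr2n -[x *+ 2]mulr_natr mulfK ?pnatr_eq0.
Qed.

(* The denominator vanishes when K = 1. *)
Definition critical_d (R : realType) (K : nat) : \bar R :=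
  if K == 1%N then +oo%E
  else (1 / (K%:R * arccosh (2 - cos (2 * pi * (K./2)%:R / K%:R))))%:E.

(* Main.v *)
Require Import Defs.
From mathcomp Require Import all_boot all_order all_algebra.
From mathcomp Require Import all_classical all_reals all_analysis.
From mathcomp.real_closed Require Import complex.
From mathcomp Require Import ring lra zify.
Import Order.TTheory GRing.Theory Num.Theory.
Local Open Scope ring_scope.
Set Implicit Arguments.
Unset Strict Implicit.

(** Put [D = d^2 n^2] and let [r > 1] solve [D (r + 1/r - 2) = 1]
([decay_rate]).  Away from its sources, a solution of [D L f - f + h = 0] on the
cycle is a combination of [r^k] and [r^-k].  Let [m = n / K] be the distance
between neighbouring spikes.  Eliminating the nodes between the spikes leaves a
relation between the values [f_q = f(qm)] at three consecutive spikes
([spike_relation]):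
[[
  D s_1 (t_m f_{q+1} - f_{q+2} - f_q) = s_m h_{q+1},
  s_k = r^k - r^-k,   t_k = r^k + r^-k.
]]

For the steady state all [f_q] equal [C] and [h_q = C^2], whence
[C s_m = D s_1 (t_m - 2)] ([spike_height]).  Since [f] is determined by its
values at the spikes ([screened_eq0]), the symmetric solution is unique; it is
[C] times a normalised sum of two exponentials ([symmetric_spike_exists]).

For the linearisation with [Re lambda >= 0], the first equation forces [phi = 0]
off the spikes and [psi = (1 - lambda) phi] on them, and the relation becomes
[[
  2 (t_m - 2) phi_{q+1} = (1 - lambda) (t_m phi_{q+1} - phi_{q+2} - phi_q).
]]
Thus [phi] is an eigenvector of the adjacency operator of the [K]-cycle, whose
eigenvalues are [z + 1/z = 2 Re z] with [z^K = 1] ([periodic_three_term],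
[unity_root_Re]), and [2 (t_m - 2) = (1 - lambda) (t_m - 2 Re z)].  So [lambda]
is real, and negative as soon as [t_m > 4 - 2 Re z].  The least value of [Re z]
is [cos (2 pi [K/2] / K)] ([cos_root_ge]), so it suffices that
[t_m > 2 (2 - cos (2 pi [K/2] / K))] ([stable_of_coshp]).

With [b = arccosh (2 - cos (2 pi [K/2] / K))] the right-hand side is
[e^b + e^-b], so the condition reads [r^m > e^b].  It holds for large [n]
because [r >= 1 + 1/(dn)], which gives [m ln r >= m / (dn + 1)]; this tends to
[1 / (d K)], which exceeds [b] exactly when [d < d_c]. *)

(** * The screened Poisson equation on sequences *)

(** With [r = exp theta], [sinhp r i] is [2 sinh (i theta)] and [coshp r i] is
[2 cosh (i theta)]. *)
Definition sinhp (F : fieldType) (r : F) (i : nat) : F := r ^+ i - r ^- i.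
Definition coshp (F : fieldType) (r : F) (i : nat) : F := r ^+ i + r ^- i.

Lemma sinhp0 (F : fieldType) (r : F) : sinhp r 0 = 0.
Proof. by rewrite /sinhp invr1 subrr. Qed.

Lemma sinhpSS (F : fieldType) (r : F) (i : nat) : r != 0 ->
  sinhp r i.+2 = (r + r^-1) * sinhp r i.+1 - sinhp r i.
Proof. by move=> r0; rewrite /sinhp !exprS; field; rewrite expf_neq0 // r0. Qed.

(** A solution of the three-term recurrence on the indices [0 .. m] is determined
by its values at [0] and [1]. *)
Lemma three_term_sinhp (F : fieldType) (r : F) (m : nat) (f : nat -> F) :
    r != 0 ->
    (forall i, (i.+1 < m)%N -> f i.+2 = (r + r^-1) * f i.+1 - f i) ->
  forall i, (i < m)%N ->
  sinhp r 1 * f i.+1 = sinhp r i.+1 * f 1 - sinhp r i * f 0.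
Proof.
move=> r0 frec i.
suff H : (i < m)%N -> sinhp r 1 * f i.+1 = sinhp r i.+1 * f 1 - sinhp r i * f 0
  /\ ((i.+1 < m)%N -> sinhp r 1 * f i.+2 = sinhp r i.+2 * f 1 - sinhp r i.+1 * f 0).
  by move=> /H[].
elim: i => [|i IH] im.
  split; first by rewrite sinhp0 mul0r subr0.
  by move=> m1; rewrite frec // sinhpSS // sinhp0; ring.
have [IH1 IH2] := IH (ltnW im); split; first exact: IH2.
move=> im2; rewrite frec // mulrBr mulrCA IH2 // IH1 (@sinhpSS F r i.+1) //.
by rewrite (@sinhpSS F r i) //; ring.
Qed.

(** The equation [D L f - f + h = 0] for sequences, with source [h]; it is imposed
at the positive indices only, which covers every node when [f] and [h] are
periodic. *)
Definition screened (F : fieldType) (D : F) (f h : nat -> F) : Prop :=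
  forall k, D * (f k.+2 + f k - f k.+1 *+ 2) - f k.+1 + h k.+1 = 0.

Lemma screened_rec (F : fieldType) (D r : F) (f h : nat -> F) (k : nat) :
    D * (r + r^-1 - 2) = 1 -> screened D f h ->
  D * (f k.+2 + f k) = D * (r + r^-1) * f k.+1 - h k.+1.
Proof.
move=> Dr /(_ k) e.
have -> : D * (r + r^-1) = 1 + 2 * D by rewrite -[X in _ = X + _]Dr; ring.
by apply/subr0_eq; rewrite -[RHS]e; ring.
Qed.

Lemma screened_free (F : fieldType) (D r : F) (f h : nat -> F) (k : nat) :
    D * (r + r^-1 - 2) = 1 -> screened D f h -> h k.+1 = 0 ->
  f k.+2 + f k = (r + r^-1) * f k.+1.
Proof.
move=> Dr /(screened_rec k Dr) e h0; rewrite h0 subr0 -mulrA in e.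
have D0 : D != 0 by apply: contra_eq_neq Dr => ->; rewrite mul0r eq_sym oner_neq0.
exact: (mulfI D0).
Qed.

(** The three-term formula on the interval between the spikes [q] and [q + 1], when
[h] is supported on the multiples of [m]. *)
Lemma between_spikes (F : fieldType) (D r : F) (m : nat) (f h : nat -> F)
    (q i : nat) :
    r != 0 -> D * (r + r^-1 - 2) = 1 ->
    screened D f h -> (forall k, ~~ (m %| k)%N -> h k = 0) -> (i < m)%N ->
  sinhp r 1 * f (q * m + i.+1)%N =
  sinhp r i.+1 * f (q * m + 1)%N - sinhp r i * f (q * m)%N.
Proof.
move=> r0 Dr fh hz im.
have := @three_term_sinhp F r m (fun i => f (q * m + i)%N) r0 _ i im.
rewrite addn0; apply=> k km; apply/eqP; rewrite eq_sym subr_eq eq_sym !addnS.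
apply/eqP/(screened_free Dr fh)/hz; rewrite -addnS dvdn_addr ?dvdn_mull //.
by rewrite gtnNdvd.
Qed.

(** Elimination of the nodes between spikes: the two neighbours of a spike are
expressed through the values at the adjacent spikes, once forwards and once
backwards, and substituted in the equation at the spike. *)
Lemma spike_relation (F : fieldType) (D r : F) (m : nat) (f h : nat -> F)
    (q : nat) :
    r != 0 -> D * (r + r^-1 - 2) = 1 -> (0 < m)%N ->
    screened D f h -> (forall k, ~~ (m %| k)%N -> h k = 0) ->
  D * sinhp r 1 *
    (coshp r m * f (q.+1 * m)%N - f (q.+2 * m)%N - f (q * m)%N) =
  sinhp r m * h (q.+1 * m)%N.
Proof.
case: m => // m r0 Dr _ fh hz.
have fw := between_spikes q.+1 r0 Dr fh hz (ltnSn m).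
have bw := @three_term_sinhp F r m.+1 (fun i => f (q.+1 * m.+1 - i)%N) r0.
have {}bw := bw _ m (ltnSn m).
rewrite /= subn0 in bw.
have e1 : (q.+1 * m.+1 + m.+1 = q.+2 * m.+1)%N by lia.
have e2 : (q.+1 * m.+1 - m.+1 = q * m.+1)%N by lia.
rewrite e1 in fw; rewrite e2 in bw.
have {}bw := bw _.
have /bw {}bw : forall i, (i.+1 < m.+1)%N -> f (q.+1 * m.+1 - i.+2)%N =
   (r + r^-1) * f (q.+1 * m.+1 - i.+1)%N - f (q.+1 * m.+1 - i)%N.
  move=> i im; apply/eqP; rewrite eq_sym subr_eq eq_sym addrC.
  have [k [-> -> -> ek]] : exists k, [/\ q.+1 * m.+1 - i.+2 = k,
      q.+1 * m.+1 - i.+1 = k.+1, q.+1 * m.+1 - i = k.+2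
      & k.+1 = q * m.+1 + (m - i)]%N.
    by exists (q.+1 * m.+1 - i.+2)%N; split; nia.
  apply/eqP/(screened_free Dr fh)/hz; rewrite ek dvdn_addr ?dvdn_mull //.
  by rewrite gtnNdvd; lia.
set k := (q.+1 * m.+1).-1.
have ek : (q.+1 * m.+1 = k.+1)%N by rewrite /k; nia.
rewrite ek addn1 subn1 /= in fw bw *.
have := screened_rec k Dr fh.
set a := f _ in fw *; set b := f (q * _)%N in bw *.
move: (h _) (f k.+2) (f k.+1) (f k) fw bw => H x y z fw bw e.
have -> : D * sinhp r 1 * (coshp r m.+1 * y - a - b) =
  D * (sinhp r 1 * coshp r m.+1 * y - sinhp r 1 * a - sinhp r 1 * b) by ring.
have -> : H = D * (r + r^-1) * y - D * (x + z) by rewrite e; ring.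
by rewrite fw bw /coshp /sinhp !exprS; field; rewrite r0 expf_neq0.
Qed.

(** A solution with sources at the spikes only that vanishes at the spikes is
zero. *)
Lemma screened_eq0 (F : fieldType) (D r : F) (m : nat) (f h : nat -> F) :
    r != 0 -> D * (r + r^-1 - 2) = 1 -> (0 < m)%N ->
    sinhp r 1 != 0 -> sinhp r m != 0 ->
    screened D f h -> (forall k, ~~ (m %| k)%N -> h k = 0) ->
    (forall q, f (q * m)%N = 0) ->
  forall k, f k = 0.
Proof.
move=> r0 Dr m0 s1 sm fh hz f0 k.
have f1 : f (k %/ m * m + 1)%N = 0.
  have := between_spikes (k %/ m) r0 Dr fh hz (i := m.-1).
  rewrite prednK // addnC -mulSn !f0 !mulr0 subr0 => /(_ (leqnn _)) /esym /eqP.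
  by rewrite mulf_eq0 (negPf sm) => /eqP.
rewrite (divn_eq k m); case ek: (k %% m)%N => [|i]; first by rewrite addn0 f0.
have im : (i < m)%N by have := ltn_pmod k m0; rewrite ek; lia.
have := between_spikes (k %/ m) r0 Dr fh hz im.
rewrite f1 f0 !mulr0 subr0 => /eqP.
by rewrite mulf_eq0 (negPf s1) => /eqP.
Qed.

(** The [m]-periodic extension of [r^i + r^(m - i)], [0 <= i <= m], which is up to a
factor the solution with equal sources at all multiples of [m]. *)
Definition profile (F : fieldType) (r : F) (m k : nat) : F :=
  r ^+ (k %% m) + r ^+ (m - k %% m).

Lemma profile_screened (F : fieldType) (D r c : F) (m : nat) :
    r != 0 -> D * (r + r^-1 - 2) = 1 -> (0 < m)%N ->
  screened D (fun k => c * profile r m k)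
    (fun k => if (m %| k)%N then c * (D * sinhp r 1 * (r ^+ m - 1)) else 0).
Proof.
move=> r0 Dr m0 k.
pose w i := r ^+ i + r ^+ (m - i).
have wm : w m = w 0%N by rewrite /w subnn subn0 addrC.
have pw i j : (i <= m)%N -> (j = i %[mod m])%N -> profile r m j = w i.
  move=> + e; rewrite leq_eqVlt => /predU1P[ei|im]; rewrite /profile e.
    by rewrite ei modnn -/(w 0%N) -wm -ei.
  by rewrite modn_small.
have im := ltn_pmod k m0; set i := (k %% m)%N in im.
have pk : profile r m k = w i by [].
have pk1 : profile r m k.+1 = w i.+1.
  by apply: pw => //; rewrite -addn1 -[i.+1]addn1 modnDml.
have dk : (m %| k.+1)%N = (m == i.+1).
  rewrite /dvdn -addn1 -modnDml -/i addn1.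
  case: (eqVneq m i.+1) => [<-|mi]; first by rewrite modnn.
  by rewrite modn_small // ltn_neqAle eq_sym mi.
rewrite pk pk1 dk.
(* If [k + 1] is a multiple of [m], then [k + 2] starts the next period. *)
case: eqP => [mi|/eqP mi].
  have -> : profile r m k.+2 = w 1%N.
    apply: pw => //; rewrite -[k.+2](addn2 k) -modnDml -/i addn2 mi.
    by rewrite -addn1 modnDl.
  rewrite /w mi subnn subSnn subn1 /= !exprS !expr0.
  rewrite -[X in _ - X + _]mul1r -[X in _ - X * _ + _]Dr /sinhp; field.
  by rewrite r0.
have -> : profile r m k.+2 = w i.+2.
  by apply: pw; [rewrite ltn_neqAle eq_sym mi
                | rewrite -[k.+2](addn2 k) -[i.+2]addn2 modnDml].
rewrite /w (_ : m - i.+1 = (m - i.+2).+1)%N; last lia.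
rewrite (_ : m - i = (m - i.+2).+2)%N; last lia.
rewrite !exprS -[X in _ - X + _]mul1r -[X in _ - X * _ + _]Dr; field.
by rewrite r0.
Qed.

(** * Nodes of the cycle as residues *)

(** The node of index [k] modulo [n].  Composing with [node] turns functions on the
cycle into [n]-periodic sequences. *)
Definition node (n : nat) (n0 : (0 < n)%N) (k : nat) : 'I_n :=
  Ordinal (ltn_pmod k n0).

Lemma ordS_node (n : nat) (n0 : (0 < n)%N) (k : nat) :
  ordS (node n0 k) = node n0 k.+1.
Proof. by apply: val_inj; rewrite /= -addn1 modnDml addn1. Qed.

Lemma node_ord (n : nat) (n0 : (0 < n)%N) (j : 'I_n) : node n0 j = j.
Proof. by apply: val_inj; rewrite /= modn_small. Qed.

(** The shift by one makes the predecessor of the node available as [node n0 k]. *)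
Lemma nodeS_surj (n : nat) (n0 : (0 < n)%N) (j : 'I_n) :
  exists k, j = node n0 k.+1.
Proof.
by exists (ord_pred j); rewrite -ordS_node node_ord ord_predK.
Qed.

Lemma node_eq (n : nat) (n0 : (0 < n)%N) (i j : nat) :
  (i = j %[mod n])%N -> node n0 i = node n0 j.
Proof. by move=> ij; apply: val_inj. Qed.

Lemma laplacian_node (V : zmodType) (n : nat) (n0 : (0 < n)%N)
    (v : {ffun 'I_n -> V}) (k : nat) :
  laplacian v (node n0 k.+1) =
  v (node n0 k.+2) + v (node n0 k) - v (node n0 k.+1) *+ 2.
Proof. by rewrite ffunE ordS_node -(ordS_node n0 k) ordSK. Qed.

Lemma spike_node_dvd (n K : nat) (n0 : (0 < n)%N) (k : nat) : (K %| n)%N ->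
  spike_node K (node n0 k) = (n %/ K %| k)%N.
Proof.
move=> Kn; have K0 := dvdn_gt0 n0 Kn.
have nE : n = (K * (n %/ K))%N by rewrite mulnC divnK.
apply/existsP/idP => [[i /eqP /= e]|/dvdnP[c kc]].
  rewrite modn_mod in e.
  have mn : (n %/ K %| n)%N by rewrite [X in (_ %| X)%N]nE dvdn_mull.
  rewrite (divn_eq k n) dvdn_addr ?e; last exact: dvdn_mull.
  by rewrite /dvdn modn_dvdm // -/(dvdn _ _) dvdn_mull.
exists (Ordinal (ltn_pmod (c + K.-1) K0)); apply/eqP; rewrite /= modn_mod kc.
rewrite {2 4}nE -!muln_modl; congr (_ * _)%N.
by rewrite -[in RHS]addn1 modnDml -addnA addn1 prednK // modnDr.
Qed.

(** * Eigenvalues of the cycle with K nodes *)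

(** The eigenvalues of the adjacency operator of the cycle of length [K].  Writing
[tau = z + 1/z], the sequence [w_q = y_{q+1} - z y_q] is geometric of ratio
[1/z]; either [w] is zero and [y] itself is geometric of ratio [z], or
periodicity of [w] gives [z^K = 1]. *)
Lemma periodic_three_term (F : numClosedFieldType) (K : nat) (tau : F)
    (y : nat -> F) (q0 : nat) :
    (forall q, y (q + K)%N = y q) -> y q0 != 0 ->
    (forall q, y q.+2 + y q = tau * y q.+1) ->
  exists2 z : F, z ^+ K = 1 & tau = z + z^-1.
Proof.
move=> yK y0 yrec.
pose z := (tau + sqrtC (tau ^+ 2 - 4)) / 2.
have zz : z * (tau - z) = 1.
  transitivity ((tau ^+ 2 - sqrtC (tau ^+ 2 - 4) ^+ 2) / 4).
    by rewrite /z; field.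
  by rewrite sqrtCK; field.
have z0 : z != 0 by apply: contra_eq_neq zz => ->; rewrite mul0r eq_sym oner_neq0.
have zV : z^-1 = tau - z by apply: (mulfI z0); rewrite zz mulfV.
exists z; last by rewrite zV addrC subrK.
pose w q := y q.+1 - z * y q.
have wS q : w q = w 0%N * z^-1 ^+ q.
  elim: q => [|q IH]; first by rewrite mulr1.
  rewrite exprSr mulrA -IH /w.
  have -> : y q.+2 = tau * y q.+1 - y q by rewrite -yrec addrK.
  rewrite zV (_ : _ * (tau - z) = y q.+1 * (tau - z) - y q * (z * (tau - z))).
    by rewrite zz; ring.
  by ring.
have [w0|w0] := eqVneq (w 0%N) 0.
  have yS q : y q = y 0%N * z ^+ q.
    elim: q => [|q IH]; first by rewrite mulr1.
    rewrite exprSr mulrA -IH; apply/eqP; rewrite mulrC -subr_eq0.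
    by rewrite -/(w q) wS w0 mul0r.
  have := yK q0; rewrite yS exprD mulrA -yS => /(canRL (mulKf y0)).
  by rewrite mulVf.
have : w K = w 0%N by rewrite /w -[K]add0n -addSn !yK.
rewrite wS => /(canRL (mulKf w0)); rewrite mulVf // exprVn => /(canRL (@invrK _)).
by rewrite invr1.
Qed.

(** De Moivre's formula. *)
Lemma cis_expr (R : realType) (t : R) (k : nat) :
  (cos t +i* sin t)%C ^+ k = (cos (k%:R * t) +i* sin (k%:R * t))%C.
Proof.
elim: k => [|k IH]; first by rewrite mul0r cos0 sin0.
rewrite exprS IH -natr1 mulrDl mul1r addrC cosD sinD.
by apply/eqP; rewrite eq_complex /=; apply/andP; split; apply/eqP; ring.
Qed.

Lemma cos_eq1_2pi (R : realType) (x : R) : 0 <= x -> cos x = 1 ->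
  exists j : nat, x = 2 * pi * j%:R.
Proof.
move=> x0 cx; have p0 := pi_gt0 R.
have p2 : 0 < 2 * pi :> R by rewrite mulr_gt0.
exists (Num.truncn (x / (2 * pi))); set j := Num.truncn _.
have := truncn_itv (divr_ge0 x0 (ltW p2)); rewrite -/j.
rewrite ler_pdivlMr // ltr_pdivrMr // -natr1 => /andP[j1 j2].
pose s := (x - 2 * pi * j%:R) / 2.
have cs : cos (s *+ 2) = 1.
  rewrite -cx -(periodicn (@cosD2pi R) j); congr cos.
  rewrite /s -mulr_natl (mulr_natr _ j) (mulr_natl pi) mulrC.
  by rewrite divfK ?pnatr_eq0 // subrK.
have ss : sin s = 0.
  apply/eqP; rewrite -sqrf_eq0 sin2cos2.
  by move: cs; rewrite cos_mulr2n => cs; apply/eqP; lra.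
have [s0|s0] := leP s 0; first by move: s0; rewrite /s; lra.
have : 0 < sin s by apply: sin_gt0_pi; rewrite s0 /s; lra.
by rewrite ss ltxx.
Qed.

(** Among the angles [2 pi j / K] between [0] and [pi] the largest has [j = K./2]. *)
Lemma cos_root_ge (R : realType) (K : nat) (t : R) :
    (0 < K)%N -> 0 <= t <= pi -> cos (K%:R * t) = 1 ->
  cos (2 * pi * (K./2)%:R / K%:R) <= cos t.
Proof.
move=> K0 /andP[t0 tp] ct; have p0 := pi_gt0 R.
have Kr : 0 < K%:R :> R by rewrite ltr0n.
have [j ej] := cos_eq1_2pi (mulr_ge0 (ltW Kr) t0) ct.
have jK : (j <= K./2)%N.
  have h : 2 * pi * j%:R <= K%:R * pi :> R.
    by rewrite -ej; apply: ler_wpM2l => //; exact: ltW.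
  have : (2 * j%:R <= K%:R :> R) by rewrite -(ler_pM2l p0); lra.
  by rewrite -natrM ler_nat; lia.
set t1 := 2 * pi * _ / _.
have t1E : K%:R * t1 = 2 * pi * (K./2)%:R by rewrite /t1; field; rewrite gt_eqF.
have tt1 : t <= t1.
  rewrite -(ler_pM2l Kr) ej t1E ler_pM2l ?ler_nat //; exact: mulr_gt0.
have t1p : t1 <= pi.
  rewrite -(ler_pM2l Kr) t1E mulrAC ler_pM2r // -natrM ler_nat; lia.
rewrite leNgt ltr_cos ?in_itv /= ?t0 ?tp ?t1p ?(le_trans t0) //.
by rewrite -leNgt.
Qed.

Lemma unity_root_Re (R : realType) (K : nat) (z : R[i]) :
    (0 < K)%N -> z ^+ K = 1 ->
  z + z^-1 = (2 * complex.Re z)%:C%C /\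
  cos (2 * pi * (K./2)%:R / K%:R) <= complex.Re z <= 1.
Proof.
move=> K0 zK.
have nz : `|z| = 1.
  have := congr1 Num.norm zK; rewrite normrX normr1 => /eqP.
  by rewrite pexpr_eq1 // => /eqP.
have zJ : z * (z^*)%C = 1 by rewrite -sqr_normc nz expr1n.
have z0 : z != 0 by rewrite -normr_eq0 nz oner_neq0.
have zV : z^-1 = (z^*)%C by apply: (mulfI z0); rewrite zJ mulfV.
split; first by rewrite zV addcJ rmorphM /= rmorph_nat.
have : complex.Re z ^+ 2 + complex.Im z ^+ 2 = 1.
  by apply: complexI; rewrite add_Re2_Im2 nz expr1n.
have zVK : (z^*)%C ^+ K = 1 by rewrite -zV exprVn zK invr1.
case: z zK zVK {nz zJ z0 zV} => x y /= zK zVK xy.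
have x1 : -1 <= x <= 1 by apply/andP; split; nra.
have cx : cos (acos x) = x by apply: acosK; rewrite in_itv.
have sx : sin (acos x) = `|y|.
  by rewrite sin_acos // -sqrtr_sqr; congr Num.sqrt; lra.
case/andP: (x1) => _ ->; rewrite andbT -cx; apply: cos_root_ge => //.
  by rewrite acos_ge0 // acos_lepi.
(* [cos (acos x) + i sin (acos x)] is [z] or its conjugate. *)
have : (cos (acos x) +i* sin (acos x))%C ^+ K = 1.
  by rewrite cx sx; case: (ger0P y) => _; [exact: zK | exact: zVK].
by rewrite cis_expr => -[].
Qed.

(** * Symmetric spike solutions *)

Lemma sinhp_gt0 (R : realFieldType) (r : R) (k : nat) :
  1 < r -> (0 < k)%N -> 0 < sinhp r k.
Proof.
move=> r1 k0; have rk : 1 < r ^+ k by rewrite exprn_egt1 // -lt0n.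
by rewrite subr_gt0 (lt_trans _ rk) // invf_lt1 // (lt_trans ltr01).
Qed.

Lemma coshp_gt2 (R : realFieldType) (r : R) (k : nat) :
  1 < r -> (0 < k)%N -> 2 < coshp r k.
Proof.
move=> r1 k0; have rk : 1 < r ^+ k by rewrite exprn_egt1 // -lt0n.
have r0 : 0 < r ^+ k by rewrite (lt_trans ltr01).
rewrite /coshp -subr_gt0.
have -> : r ^+ k + r ^- k - 2 = (r ^+ k - 1) ^+ 2 / r ^+ k.
  by field; rewrite gt_eqF.
by rewrite divr_gt0 // exprn_gt0 // subr_gt0.
Qed.

(** A symmetric spike solution of height [C], read along [node], solves the screened
equation with source [C^2] at the multiples of [n %/ K]. *)
Lemma solution_screened (R : realType) (n K : nat) (n0 : (0 < n)%N) (d : R)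
    (u v : {ffun 'I_n -> R}) :
    (K %| n)%N -> symmetric_spike_solution K d u v ->
  exists C, [/\ 0 < C,
    forall k, (n %/ K %| k)%N -> u (node n0 k) = C /\ v (node n0 k) = C,
    forall k, ~~ (n %/ K %| k)%N -> u (node n0 k) = 0
    & screened (d ^+ 2 * n%:R ^+ 2) (fun k => v (node n0 k))
        (fun k => if (n %/ K %| k)%N then C ^+ 2 else 0)].
Proof.
move=> Kn [st _ uz [C C0 uvC]]; exists C.
have sp k : (n %/ K %| k)%N -> u (node n0 k) = C /\ v (node n0 k) = C.
  by move=> mk; apply: uvC; rewrite spike_node_dvd.
have nsp k : ~~ (n %/ K %| k)%N -> u (node n0 k) = 0.
  by move=> mk; apply: uz; rewrite spike_node_dvd.
split=> // k; have [_] := st (node n0 k.+1); rewrite laplacian_node.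
by case: ifPn => [/sp|/nsp] => [[-> _]|->] //; rewrite expr0n.
Qed.

(** The equation for the height [C] of a symmetric spike solution. *)
Lemma spike_height (R : realType) (D r C : R) (m : nat) (f : nat -> R) :
    1 < r -> D * (r + r^-1 - 2) = 1 -> (0 < m)%N -> 0 < C ->
    screened D f (fun k => if (m %| k)%N then C ^+ 2 else 0) ->
    (forall k, (m %| k)%N -> f k = C) ->
  C * sinhp r m = D * sinhp r 1 * (coshp r m - 2).
Proof.
move=> r1 Dr m0 C0 fh fC; have r0 : r != 0 by rewrite gt_eqF // (lt_trans ltr01).
have hz k : ~~ (m %| k)%N -> (if (m %| k)%N then C ^+ 2 else 0) = 0.
  by move=> /negPf ->.
have := spike_relation 0 r0 Dr m0 fh hz; rewrite !fC ?dvdn_mull // => h.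
have Cn : C != 0 by rewrite gt_eqF.
by apply: (mulfI Cn); lra.
Qed.

Lemma symmetric_spike_unique (R : realType) (n K : nat) (d r : R)
    (u v u' v' : {ffun 'I_n -> R}) :
    (0 < n)%N -> (K %| n)%N -> 1 < r ->
    d ^+ 2 * n%:R ^+ 2 * (r + r^-1 - 2) = 1 ->
    symmetric_spike_solution K d u v -> symmetric_spike_solution K d u' v' ->
  u' = u /\ v' = v.
Proof.
move=> n0 Kn r1 Dr.
have m0 : (0 < n %/ K)%N by rewrite divn_gt0 ?(dvdn_gt0 n0 Kn) // dvdn_leq.
have r0 : r != 0 by rewrite gt_eqF // (lt_trans ltr01).
move=> /(solution_screened n0 Kn)[C [C0 sp nsp scr]].
move=> /(solution_screened n0 Kn)[C' [C'0 sp' nsp' scr']].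
have h := spike_height r1 Dr m0 C0 scr (fun k mk => (sp k mk).2).
have h' := spike_height r1 Dr m0 C'0 scr' (fun k mk => (sp' k mk).2).
have sm : sinhp r (n %/ K) != 0 by rewrite gt_eqF // sinhp_gt0.
have s1 : sinhp r 1 != 0 by rewrite gt_eqF // sinhp_gt0.
have CC : C' = C by apply: (mulIf sm); rewrite h h'.
split; apply/ffunP => j; have [k ->] := nodeS_surj n0 j.
  case: (boolP (n %/ K %| k.+1)%N) => [mk|mk].
    by rewrite (sp _ mk).1 (sp' _ mk).1.
  by rewrite nsp // nsp'.
apply/eqP; rewrite -subr_eq0; apply/eqP.
apply: (screened_eq0 (D := d ^+ 2 * n%:R ^+ 2) (h := fun=> 0)
  (f := fun k => v' (node n0 k) - v (node n0 k)) r0 Dr m0 s1 sm) => [i|//|q].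
  have := scr i; have := scr' i; rewrite CC => e' e.
  by rewrite addr0 /=; lra.
by rewrite (sp _ (dvdn_mull _ _)).2 ?(sp' _ (dvdn_mull _ _)).2 // CC subrr.
Qed.

Lemma symmetric_spike_exists (R : realType) (n K : nat) (d r : R) :
    (0 < n)%N -> (K %| n)%N -> 0 < d -> 1 < r ->
    d ^+ 2 * n%:R ^+ 2 * (r + r^-1 - 2) = 1 ->
  exists u v : {ffun 'I_n -> R}, symmetric_spike_solution K d u v.
Proof.
move=> n0 Kn d0 r1 Dr; set D := d ^+ 2 * _ in Dr.
have m0 : (0 < n %/ K)%N by rewrite divn_gt0 ?(dvdn_gt0 n0 Kn) // dvdn_leq.
have mn : (n %/ K %| n)%N by rewrite -[X in (_ %| X)%N](divnK Kn) dvdn_mulr.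
set m := (n %/ K)%N in m0 mn *.
have rp : 0 < r by rewrite (lt_trans ltr01).
have r0 : r != 0 by rewrite gt_eqF.
have rm : 1 < r ^+ m by rewrite exprn_egt1 // -lt0n.
have D0 : 0 < D by rewrite mulr_gt0 ?exprn_gt0 ?ltr0n.
have rm1 : 0 < r ^+ m + 1 by lra.
(* The solution of [C s_m = D s_1 (t_m - 2)], after cancelling [r^m - 1]. *)
pose C := D * sinhp r 1 * (r ^+ m - 1) / (r ^+ m + 1).
have C0 : 0 < C.
  by rewrite divr_gt0 // mulr_gt0 ?subr_gt0 // mulr_gt0 // sinhp_gt0.
pose c := C / (r ^+ m + 1).
have c0 : 0 < c by rewrite divr_gt0.
have scr := profile_screened c r0 Dr m0.
have prof0 k : (m %| k)%N -> c * profile r m k = C.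
  move=> /eqP mk; rewrite /profile mk subn0 /c expr0 [1 + _]addrC.
  by rewrite divfK // gt_eqF.
pose u := [ffun j : 'I_n => if (m %| j)%N then C else 0].
pose v := [ffun j : 'I_n => c * profile r m j].
have uE k : u (node n0 k) = if (m %| k)%N then C else 0.
  by rewrite ffunE /dvdn /= modn_dvdm.
have vE k : v (node n0 k) = c * profile r m k.
  by rewrite ffunE /profile /= modn_dvdm.
exists u, v; split=> [j|j|j|].
- have [k ->] := nodeS_surj n0 j; rewrite laplacian_node !vE uE; split.
    case: ifPn => [mk|_]; last by rewrite oppr0 expr0n mul0r addr0.
    by rewrite prof0 // expr2 mulfK ?gt_eqF // addNr.
  have := scr k; case: ifP => _; last by rewrite expr0n.
  by move=> <-; congr (_ + _); rewrite /c mulrAC -mulrA expr2.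
- have [k ->] := nodeS_surj n0 j.
  by rewrite vE mulr_gt0 // addr_gt0 // exprn_gt0.
- have [k ->] := nodeS_surj n0 j.
  by rewrite spike_node_dvd // -/m uE => /negPf ->.
- exists C => // j; have [k ->] := nodeS_surj n0 j.
  by rewrite spike_node_dvd // -/m uE vE => mk; rewrite mk prof0.
Qed.

(** An eigenvalue with nonnegative real part would yield an eigenvector of the
[K]-cycle with an eigenvalue that the lower bound on [coshp] excludes. *)
Lemma stable_of_coshp (R : realType) (n K : nat) (d r : R)
    (u v : {ffun 'I_n -> R}) :
    (0 < n)%N -> (K %| n)%N -> 1 < r ->
    d ^+ 2 * n%:R ^+ 2 * (r + r^-1 - 2) = 1 ->
    2 * (2 - cos (2 * pi * (K./2)%:R / K%:R)) < coshp r (n %/ K) ->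
    symmetric_spike_solution K d u v ->
  linearly_stable d u v.
Proof.
move=> n0 Kn r1 Dr; have K0 := dvdn_gt0 n0 Kn.
have m0 : (0 < n %/ K)%N by rewrite divn_gt0 // dvdn_leq.
have nE : (K * (n %/ K) = n)%N by rewrite mulnC divnK.
have r0 : r != 0 by rewrite gt_eqF // (lt_trans ltr01).
have s10 := sinhp_gt0 r1 (ltn0Sn 0).
have sm0 := sinhp_gt0 r1 m0.
have t2 := coshp_gt2 r1 m0.
set g := cos _ => tg /(solution_screened n0 Kn)[C [C0 sp nsp scr]].
have h := spike_height r1 Dr m0 C0 scr (fun k mk => (sp k mk).2).
set D := d ^+ 2 * _ in Dr scr h.
set m := (n %/ K)%N in m0 sm0 t2 nE tg sp nsp scr h.
move=> lam [phi [psi [nz eqs]]]; rewrite ltNge; apply/negP => lam0.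
pose a k := phi (node n0 k); pose b k := psi (node n0 k).
have l1 : lam + 1 != 0.
  apply: contraTneq lam0 => /eqP; rewrite addr_eq0 => /eqP ->.
  by rewrite /= -ltNge; lra.
have eqn k : lam * a k = - a k
    + (2 * u (node n0 k) / v (node n0 k))%:C%C * a k
    - (u (node n0 k) ^+ 2 / v (node n0 k) ^+ 2)%:C%C * b k.
  by have [] := eqs (node n0 k).
have a0 k : ~~ (m %| k)%N -> a k = 0.
  move=> mk; have := eqn k; rewrite (nsp _ mk) mulr0 expr0n !mul0r addr0 subr0.
  move=> /eqP; rewrite -subr_eq0 opprK -[X in _ + X]mul1r -mulrDl.
  by rewrite mulf_eq0 (negPf l1) => /eqP.
have ab k : (m %| k)%N -> b k = (1 - lam) * a k.
  move=> mk; have := eqn k; rewrite !(sp _ mk).1 !(sp _ mk).2.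
  rewrite mulfK ?gt_eqF // divff ?expf_neq0 ?gt_eqF // mul1r.
  by rewrite rmorph_nat => e; rewrite mulrBl e; ring.
have scb : screened D%:C%C b (fun k => (2 * C)%:C%C * a k).
  move=> k; have [_] := eqs (node n0 k.+1); rewrite laplacian_node => e.
  rewrite [RHS]e.
  rewrite -/(a _) -!/(b _); congr (_ + _).
  by case: (boolP (m %| k.+1)%N) => mk; rewrite ?(sp _ mk).1 // a0 ?mulr0.
(* The complex equation has the same decay rate [r]. *)
pose rc : R[i] := r%:C%C.
have rc0 : rc != 0 by rewrite fmorph_eq0.
have Drc : D%:C%C * (rc + rc^-1 - 2) = 1.
  rewrite /rc -fmorphV -(rmorph_nat (real_complex R)).
  by rewrite -rmorphD -rmorphB -rmorphM Dr.
have sE k : sinhp rc k = (sinhp r k)%:C%C.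
  by rewrite /sinhp rmorphB fmorphV rmorphXn.
have tE k : coshp rc k = (coshp r k)%:C%C.
  by rewrite /coshp rmorphD fmorphV rmorphXn.
have hz k : ~~ (m %| k)%N -> (2 * C)%:C%C * a k = 0 by move=> /a0 ->; rewrite mulr0.
(* Some spike carries a nonzero [phi]: otherwise [phi] and [psi] both vanish. *)
have [q0 aq0] : exists q, a (q * m)%N != 0.
  apply: contrapT => /forallNP az; apply: nz; congr (_, _); apply/ffunP => j;
    rewrite ffunE; have [k ->] := nodeS_surj n0 j.
    case: (boolP (m %| k.+1)%N) => [/dvdnP[q ->]|/a0 //].
    by apply/eqP/negP => /negP /az.
  apply: (screened_eq0 rc0 Drc m0 _ _ scb hz) => [||q].
  - by rewrite sE fmorph_eq0 gt_eqF.
  - by rewrite sE fmorph_eq0 gt_eqF.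
  - rewrite ab ?dvdn_mull // (_ : a _ = 0) ?mulr0 //.
    by apply/eqP/negP => /negP /az.
pose y q := a (q * m)%N.
have yK q : y (q + K)%N = y q.
  by rewrite /y /a mulnDl nE; congr (phi _); apply: node_eq; rewrite modnDr.
pose c := coshp r m.
have key q : (2 * (c - 2))%:C%C * y q.+1 =
    (1 - lam) * (c%:C%C * y q.+1 - y q.+2 - y q).
  have := spike_relation q rc0 Drc m0 scb hz.
  rewrite !ab ?dvdn_mull // !sE tE -/(y _) -!/(y _) -/c => e.
  have k0 : (D * sinhp r 1)%:C%C != 0.
    have D0 : D != 0.
      by apply: contra_eq_neq Dr => ->; rewrite mul0r eq_sym oner_neq0.
    by rewrite fmorph_eq0 mulf_neq0 // gt_eqF.
  apply: (mulfI k0).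
  have -> : (D * sinhp r 1)%:C%C * ((2 * (c - 2))%:C%C * y q.+1) =
     (sinhp r m)%:C%C * ((2 * C)%:C%C * y q.+1).
    rewrite !mulrA -!rmorphM; congr (_%:C%C * _); rewrite -/c in h; lra.
  by rewrite -e [(D * sinhp r 1)%:C%C]rmorphM /=; ring.
have l1' : 1 - lam != 0.
  apply: contraNneq aq0 => l0; have := key (q0 + K.-1)%N.
  rewrite l0 mul0r -addnS prednK // yK => /eqP.
  by rewrite mulf_eq0 fmorph_eq0 mulf_eq0 pnatr_eq0 subr_eq0 (gt_eqF t2).
pose tau := c%:C%C - (2 * (c - 2))%:C%C / (1 - lam).
have yrec q : y q.+2 + y q = tau * y q.+1.
  have tauE : (1 - lam) * tau = (1 - lam) * c%:C%C - (2 * (c - 2))%:C%C.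
    by rewrite /tau mulrBr [in X in _ - X]mulrC divfK.
  by apply: (mulfI l1'); rewrite mulrA tauE [RHS]mulrBl key; ring.
have [z zK tauz] := periodic_three_term yK aq0 yrec.
have [zR /andP[]] := unity_root_Re K0 zK; rewrite -/g.
move: zR; move: (complex.Re z) => x zR xg x1.
have fin : (1 - lam) * (c - 2 * x)%:C%C = (2 * (c - 2))%:C%C.
  have -> : (c - 2 * x)%:C%C = c%:C%C - tau by rewrite tauz zR -rmorphB.
  by rewrite /tau subKr mulrC divfK.
have := congr1 (@complex.Re R) fin.
case: lam lam0 {fin tau yrec key l1 l1' eqs eqn ab tauz nz} => l1 l2 /= lam0.
rewrite /= mulr0 subr0 => fin.
have : 0 <= l1 * (c - 2 * x) by apply: mulr_ge0 => //; rewrite -/c in t2; lra.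
by rewrite -/c in tg; lra.
Qed.

(** * The stability threshold *)

(** The root [r > 1] of [r + 1/r = 2 + e^2], with a lower bound that is sharp to
first order in [e]. *)
Lemma decay_rate (R : rcfType) (e : R) : 0 < e ->
  exists2 r, 1 + e <= r & r + r^-1 - 2 = e ^+ 2.
Proof.
move=> e0; pose s := Num.sqrt (e ^+ 2 + e ^+ 4 / 4).
have e2 : 0 < e ^+ 2 by rewrite exprn_gt0.
have ss : s ^+ 2 = e ^+ 2 + e ^+ 4 / 4.
  by rewrite sqr_sqrtr // addr_ge0 ?divr_ge0 ?exprn_ge0 // ltW.
have es : e <= s.
  rewrite -ler_sqr ?nnegrE ?sqrtr_ge0 ?(ltW e0) // ss lerDl.
  by rewrite divr_ge0 // exprn_ge0 // ltW.
have r0 : 0 < 1 + e ^+ 2 / 2 + s by lra.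
(* The larger root of [r^2 - (2 + e^2) r + 1 = 0]. *)
exists (1 + e ^+ 2 / 2 + s); first lra.
have -> : (1 + e ^+ 2 / 2 + s)^-1 = 1 + e ^+ 2 / 2 - s.
  apply: (mulfI (lt0r_neq0 r0)); rewrite mulfV ?lt0r_neq0 // mulrC -subr_sqr ss.
  by field.
by field.
Qed.

(** This follows from [ln r >= ln (1 + e) >= e / (1 + e)]. *)
Lemma expr_gt_expR (R : realType) (b e r : R) (m : nat) :
  0 < e -> 1 + e <= r -> b * (1 + e) < m%:R * e -> expR b < r ^+ m.
Proof.
move=> e0 er be; have e1 : 0 < 1 + e by lra.
have r0 : 0 < r by lra.
rewrite -[r]lnK ?posrE // -expRM_natl ltr_expR.
have le : e / (1 + e) <= ln r.
  rewrite -[ln r]opprK -lnV ?posrE // lerNr.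
  have h : r^-1 - 1 <= - (e / (1 + e)).
    have -> : - (e / (1 + e)) = (1 + e)^-1 - 1 by field; rewrite gt_eqF.
    by rewrite lerB // lef_pV2 ?posrE.
  apply: le_trans h; rewrite -ler_expR lnK ?posrE ?invr_gt0 //.
  by have := expR_ge1Dx (r^-1 - 1); rewrite addrC subrK.
have m0 : 0 <= m%:R :> R by [].
by apply: lt_le_trans (ler_wpM2l m0 le); rewrite mulrA ltr_pdivlMr.
Qed.

Lemma ltrD_inv (R : realFieldType) (x y : R) :
  1 <= x -> x < y -> x + x^-1 < y + y^-1.
Proof.
move=> x1 xy; rewrite -subr_gt0.
have x0 : 0 < x by lra.
have y0 : 0 < y by lra.
have -> : y + y^-1 - (x + x^-1) = (y - x) * (x * y - 1) / (x * y).
  by field; rewrite !gt_eqF.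
rewrite divr_gt0 ?mulr_gt0 ?subr_gt0 //; nra.
Qed.

(** The condition [d < d_c] without division, which includes the case [K = 1], where
the [arccosh] vanishes. *)
Lemma critical_d_gt (R : realType) (K : nat) (d : R) :
    (0 < K)%N -> 0 < d -> (d%:E < critical_d R K)%E ->
  d * (K%:R * arccosh (2 - cos (2 * pi * (K./2)%:R / K%:R))) < 1.
Proof.
move=> K0 d0; rewrite /critical_d; case: eqP => [->|_].
  rewrite /= mulr0 mul0r cos0 /arccosh -[2]/(1 + 1) addrK expr1n subrr sqrtr0.
  by rewrite addr0 ln1 !mulr0.
set b := arccosh _; rewrite lte_fin => db.
have b0 : 0 <= K%:R * b.
  rewrite mulr_ge0 // arccosh_ge0 //.
  by have := cos_le1 (2 * pi * (K./2)%:R / K%:R : R); lra.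
have b1 : 0 < K%:R * b.
  rewrite lt_neqAle b0 andbT; apply: contraTneq db => <-.
  by rewrite invr0 mulr0 -leNgt ltW.
by move: db; rewrite ltr_pdivlMr.
Qed.

Theorem mainTheorem3 (R : realType) (K : nat) (d : R) :
  (1 <= K)%N -> 0 < d -> (d%:E < critical_d R K)%E ->
  exists N : nat, forall n : nat, (N <= n)%N -> (K %| n)%N ->
    exists u v : {ffun 'I_n -> R},
      [/\ symmetric_spike_solution K d u v,
          forall u' v' : {ffun 'I_n -> R},
            symmetric_spike_solution K d u' v' -> u' = u /\ v' = v
        & linearly_stable d u v].
Proof.
move=> K0 d0 /(critical_d_gt K0 d0).
set g := cos _; set b := arccosh _ => db.
have g1 : 1 <= 2 - g.
  by have := cos_le1 (2 * pi * (K./2)%:R / K%:R : R); rewrite -/g; lra.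
have b0 : 0 <= b by exact: arccosh_ge0.
have Kr : 0 < K%:R :> R by rewrite ltr0n.
(* From this [N] on, [K b < n (1 - d K b)], that is [K b < n / (d n + 1)]. *)
exists (Num.truncn (K%:R * b / (1 - d * (K%:R * b)))).+1 => n Nn Kn.
have n0 : (0 < n)%N by exact: leq_trans Nn.
have nr : 0 < n%:R :> R by rewrite ltr0n.
have m0 : (0 < n %/ K)%N by rewrite divn_gt0 // dvdn_leq.
have nE : n%:R = K%:R * (n %/ K)%:R :> R by rewrite -natrM mulnC divnK.
have nb : K%:R * b < n%:R * (1 - d * (K%:R * b)).
  rewrite -ltr_pdivrMr ?subr_gt0 //.
  by apply: lt_le_trans (truncnS_gt _) _; rewrite ler_nat.
have [r er Dr] := decay_rate (divr_gt0 ltr01 (mulr_gt0 d0 nr)).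
set e := 1 / (d * n%:R) in er Dr.
have e0 : 0 < e by rewrite divr_gt0 // mulr_gt0.
have r1 : 1 < r by lra.
have {}Dr : d ^+ 2 * n%:R ^+ 2 * (r + r^-1 - 2) = 1.
  by rewrite Dr /e; field; rewrite !gt_eqF.
have tg : 2 * (2 - g) < coshp r (n %/ K).
  have -> : 2 * (2 - g) = expR b + (expR b)^-1.
    rewrite -expRN -[in LHS](arccoshK g1) -/b.
    by field.
  rewrite /coshp; apply: ltrD_inv; first by rewrite -expR0 ler_expR.
  apply: (expr_gt_expR e0 er).
  have ed : e * (d * n%:R) = 1 by rewrite /e divfK // mulf_neq0 // gt_eqF.
  have Kdn : 0 < K%:R * (d * n%:R) by rewrite !mulr_gt0.
  rewrite -(ltr_pM2l Kdn).
  have -> : K%:R * (d * n%:R) * (b * (1 + e)) =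
      K%:R * b * (d * n%:R + e * (d * n%:R)) by ring.
  have -> : K%:R * (d * n%:R) * ((n %/ K)%:R * e) =
      K%:R * (n %/ K)%:R * (e * (d * n%:R)) by ring.
  by rewrite ed -nE; lra.
have [u [v uv]] := symmetric_spike_exists n0 Kn d0 r1 Dr.
exists u, v; split=> //; last exact: (stable_of_coshp n0 Kn r1 Dr tg uv).
by move=> u' v' uv'; apply: (symmetric_spike_unique n0 Kn r1 Dr) uv uv'.
Qed.
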